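(* There exists a finitely generated residually finite group $G$ with solvable word problem such that $G$ does not embed in any finitely presented residually finite group (that is, $G$ is not isomorphic to a subgroup of any finitely presented residually finite group).
   Context: A group $G$ is residually finite if for every $g\neq e$ in $G$ there is a morphism $\varphi$ from $G$ to a finite group with $\varphi(g)\neq e$. A finitely generated group has solvable word problem if there is an algorithm that, given a word on a finite generating set and its inverses, decides whether the word represents the identity element (this does not depend on the finite generating set). *)

(* Defs.v *)
From mathcomp Require Import all_boot all_fingroup.
Set Implicit Arguments.
Unset Strict Implicit.
Unset Printing Implicit Defensive.

(* Algorithms are partial recursive (mu-recursive) functions. A code has no
   fixed arity: it is applied to a list of arguments, in which missing arguments
   count as 0 and superfluous ones are ignored. This gives the same functions
   as the usual presentation with arities. *)
Inductive murec : Type :=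
  | Mzero
  | Msucc
  | Mproj of nat
  | Mcomp of murec & seq murec
  | Mprec of murec & murec
  | Mmin of murec.

Section Semantics.
Variable (C : Type) (graph : C -> seq nat -> nat -> Prop).

Fixpoint args_graph (gs : seq C) (v w : seq nat) : Prop :=
  match gs, w with
  | [::], [::] => True
  | g :: gs', x :: w' => graph g v x /\ args_graph gs' v w'
  | _, _ => False
  end.

End Semantics.

Fixpoint rec_graph (base : nat -> Prop) (step : nat -> nat -> nat -> Prop)
    (n y : nat) : Prop :=
  if n is n'.+1 then exists2 z, rec_graph base step n' z & step n' z y
  else base y.

(* [computes c v y]: the computation of c on v terminates with value y.
   Conventions for primitive recursion, h = Mprec f g:
     h (0 :: v) = f v,   h (n.+1 :: v) = g (n :: h (n :: v) :: v). *)
Fixpoint computes (c : murec) (v : seq nat) (y : nat) {struct c} : Prop :=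
  match c with
  | Mzero => y = 0
  | Msucc => y = (head 0 v).+1
  | Mproj i => y = nth 0 v i
  | Mcomp f gs => exists2 w, args_graph computes gs v w & computes f w y
  | Mprec f g =>
      rec_graph (computes f (behead v))
                (fun n z => computes g [:: n, z & behead v]) (head 0 v) y
  | Mmin f =>
      computes f (y :: v) 0 /\
      forall i, i < y -> exists z, computes f (i :: v) z.+1
  end.

(* Words in n letters and their inverses; (i, true) is the inverse of the
   i-th letter. *)
Definition letter (n : nat) := ('I_n * bool)%type.
Definition word (n : nat) := seq (letter n).

Definition letter_inv n (l : letter n) : letter n := (l.1, ~~ l.2).

Definition encode_word n (w : word n) : nat :=
  CodeSeq.code [seq (nat_of_ord l.1).*2 + l.2 | l : letter n <- w].

Definition decidable_words n (L : pred (word n)) : Prop :=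
  exists c : murec, forall w : word n, computes c [:: encode_word w] (L w).

Local Open Scope group_scope.

Definition eval_letter (G : groupType) n (a : 'I_n -> G) (l : letter n) : G :=
  if l.2 then (a l.1)^-1 else a l.1.

Definition eval_word (G : groupType) n (a : 'I_n -> G) (w : word n) : G :=
  \prod_(l <- w) eval_letter a l.

Definition generates (G : groupType) n (a : 'I_n -> G) : Prop :=
  forall g : G, exists w : word n, eval_word a w = g.

Definition finitely_generated (G : groupType) : Prop :=
  exists n (a : 'I_n -> G), generates a.

Definition solvable_word_problem (G : groupType) : Prop :=
  exists n (a : 'I_n -> G),
    generates a /\ decidable_words [pred w | eval_word a w == 1].

(* The group presented by n generators and relators R is the quotient of the
   words by the congruence presented_eq R. *)
Inductive presented_eq n (R : seq (word n)) : word n -> word n -> Prop :=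
  | presented_refl u : presented_eq R u u
  | presented_sym u v : presented_eq R u v -> presented_eq R v u
  | presented_trans u v w :
      presented_eq R u v -> presented_eq R v w -> presented_eq R u w
  | presented_cancel u v l :
      presented_eq R (u ++ [:: l; letter_inv l] ++ v) (u ++ v)
  | presented_relator u v r :
      r \in R -> presented_eq R (u ++ r ++ v) (u ++ v).

(* The map induced by a is an isomorphism from that quotient onto G. *)
Definition presents (G : groupType) n (a : 'I_n -> G) (R : seq (word n)) :
    Prop :=
  generates a /\
  forall u v : word n, presented_eq R u v <-> eval_word a u = eval_word a v.

Definition finitely_presented (G : groupType) : Prop :=
  exists n (a : 'I_n -> G) (R : seq (word n)), presents a R.

Definition residually_finite (G : groupType) : Prop :=
  forall g : G, g <> 1 ->
  exists (F : finGroupType) (phi : {multiplicative G -> F}), phi g <> 1.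

Definition embeds (G H : groupType) : Prop :=
  exists phi : {multiplicative G -> H}, injective phi.

(* Main.v *)
(* Idea. Consider tapes over Z/M of lamps in F_2 with a head: A switches
   the lamp under the head, B adds to a register the lamp at distance d from the
   head, T moves the head. In the group generated by A, B, T acting on all the
   tapes with d <> a mod M for every a in S, the commutator c_m of the conjugate
   of A by T^m with B is trivial iff m is in S, provided that S is closed in the
   profinite topology; if S is moreover decidable, so is the word problem.

   S diagonalizes against the finitely presented groups. A number e codes a list
   of relators, among which are those expressing A, B, T in the generators of an
   overgroup H; a number s codes a finite action of the generators. If s is the
   first action that satisfies the relators e and in which c_(e!) is nontrivial,
   put e! + (e + s + 2)! in S. Residual finiteness of H provides such an s when
   e comes from an embedding into H, because e! is never in S. In this action
   T^((e + s + 2)!) is the identity, so c_a with a = e! + (e + s + 2)! acts as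
   c_(e!), although a is in S. Each e contributes at most one point to S, and
   these points tend to 0 in the profinite topology, so S with 0 is closed. *)
From HB Require Import structures.
Require Import Defs.
From mathcomp Require Import all_boot all_order all_fingroup all_solvable.
From mathcomp Require Import all_algebra zify ring.
From Stdlib Require Import Classical.
Set Implicit Arguments.
Unset Strict Implicit.
Unset Printing Implicit Defensive.
Import GRing.Theory.

(** * Words and residual quotients *)

(* In three letters A, B, T the codes 0 to 5 are A, A^-1, B, B^-1, T, T^-1. *)
Definition letter_code n (l : letter n) : nat := (nat_of_ord l.1).*2 + l.2.
Definition word_code n (w : word n) : seq nat := map (@letter_code n) w.

Section WordEval.
Local Open Scope group_scope.
Variables (G : groupType) (n : nat) (a : 'I_n -> G).

Definition word_inv (w : word n) : word n := rev (map (@letter_inv n) w).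

Lemma eval_word_cat u v : eval_word a (u ++ v) = eval_word a u * eval_word a v.
Proof. exact: big_cat. Qed.

Lemma eval_word_cons l w : eval_word a (l :: w) = eval_letter a l * eval_word a w.
Proof. exact: big_cons. Qed.

Lemma eval_word1 : eval_word a [::] = 1.
Proof. exact: big_nil. Qed.

Lemma eval_letter_inv l : eval_letter a (letter_inv l) = (eval_letter a l)^-1.
Proof. by case: l => i []; rewrite /eval_letter //= invgK. Qed.

Lemma eval_word_inv w : eval_word a (word_inv w) = (eval_word a w)^-1.
Proof.
elim: w => [|l w IHw]; first by rewrite /word_inv /= !eval_word1 invg1.
rewrite /word_inv /= rev_cons -cats1 eval_word_cat IHw !eval_word_cons.
by rewrite eval_word1 mulg1 eval_letter_inv invgM.
Qed.

End WordEval.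

Lemma multiplicative1 (G H : groupType) (phi : {multiplicative G -> H}) :
  phi 1%g = 1%g.
Proof. by apply: (mulgI (phi 1%g)); rewrite -gmulfM !mulg1. Qed.

Lemma multiplicativeV (G H : groupType) (phi : {multiplicative G -> H}) x :
  phi x^-1%g = (phi x)^-1%g.
Proof.
by apply: (mulgI (phi x)); rewrite -gmulfM !mulgV multiplicative1.
Qed.

Lemma eval_word_morph (G H : groupType) (phi : {multiplicative G -> H}) n
    (a : 'I_n -> G) w :
  phi (eval_word a w) = eval_word (phi \o a) w.
Proof.
elim: w => [|[i b] w IHw]; first by rewrite !eval_word1 multiplicative1.
by rewrite !eval_word_cons gmulfM IHw /eval_letter /=; case: b;
  rewrite ?multiplicativeV.
Qed.

(** * The group separated by a family of quotients *)

Section ResidualGroup.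
Local Open Scope group_scope.
Local Open Scope quotient_scope.
Variables (n : nat) (I : Type) (K : I -> groupType).
Variables (a : forall i, 'I_n -> K i) (T : pred (word n)).
Hypothesis TP : forall w, T w <-> forall i, eval_word (a i) w = 1.

Let rel_T (u v : word n) := T (u ++ word_inv v).

Let rel_TP u v : rel_T u v <-> forall i, eval_word (a i) u = eval_word (a i) v.
Proof.
split=> [/TP uv i | uv].
  by have := uv i; rewrite eval_word_cat eval_word_inv => /(canRL (mulgVK _));
    rewrite mul1g.
by apply/TP => i; rewrite eval_word_cat eval_word_inv uv mulgV.
Qed.

Let rel_T_refl : reflexive rel_T.
Proof. by move=> u; apply/rel_TP. Qed.

Let rel_T_sym : symmetric rel_T.
Proof. by move=> u v; apply/idP/idP => /rel_TP uv; apply/rel_TP => i; rewrite uv. Qed.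

Let rel_T_trans : transitive rel_T.
Proof. by move=> v u w /rel_TP uv /rel_TP vw; apply/rel_TP => i; rewrite uv vw. Qed.

Let eqv := EquivRel rel_T rel_T_refl rel_T_sym rel_T_trans.
Local Notation Q := {eq_quot eqv}.

Let piP u v : reflect (\pi_Q u = \pi_Q v) (rel_T u v).
Proof. exact: (@eqquotP _ eqv Q u v). Qed.

Let ev i (q : Q) : K i := eval_word (a i) (generic_quotient.repr q).

Let ev_pi i w : ev i (\pi_Q w) = eval_word (a i) w.
Proof. by move: i; apply/rel_TP; apply/piP; rewrite reprK. Qed.

(** The evaluations separate the points of the quotient, so every group law is inherited from the
    [K i]. *)
Let ev_inj q q' : (forall i, ev i q = ev i q') -> q = q'.
Proof.
move=> eq_q; rewrite -[q]reprK -[q']reprK; apply/piP.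
exact/rel_TP.
Qed.

Let mulQ (q q' : Q) : Q := \pi_Q (generic_quotient.repr q ++ generic_quotient.repr q').
Let oneQ : Q := \pi_Q [::].
Let invQ (q : Q) : Q := \pi_Q (word_inv (generic_quotient.repr q)).

Let ev_mul i q q' : ev i (mulQ q q') = ev i q * ev i q'.
Proof. by rewrite ev_pi eval_word_cat. Qed.

Let ev_one i : ev i oneQ = 1.
Proof. by rewrite ev_pi eval_word1. Qed.

Let ev_inv i q : ev i (invQ q) = (ev i q)^-1.
Proof. by rewrite ev_pi eval_word_inv. Qed.

Let mulQA : associative mulQ.
Proof. by move=> x y z; apply: ev_inj => i; rewrite !ev_mul mulgA. Qed.
Let mul1Q : left_id oneQ mulQ.
Proof. by move=> x; apply: ev_inj => i; rewrite !ev_mul ev_one mul1g. Qed.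
Let mulQ1 : right_id oneQ mulQ.
Proof. by move=> x; apply: ev_inj => i; rewrite !ev_mul ev_one mulg1. Qed.
Let mulVQ : left_inverse oneQ invQ mulQ.
Proof. by move=> x; apply: ev_inj => i; rewrite ev_mul ev_one ev_inv mulVg. Qed.
Let mulQV : right_inverse oneQ invQ mulQ.
Proof. by move=> x; apply: ev_inj => i; rewrite ev_mul ev_one ev_inv mulgV. Qed.

(** This is the subgroup of the product of the [K i] generated by the families [a i]. Building it as
    a quotient of words by the boolean relation [rel_T] makes its equality decided by [T]. *)
Lemma residual_group : exists (G : groupType) (g : 'I_n -> G),
  [/\ generates g, forall w, (eval_word g w == 1) = T w &
      forall i, exists phi : {multiplicative G -> K i},
        forall w, phi (eval_word g w) = eval_word (a i) w].
Proof.
pose G : groupType := HB.pack Q (isGroup.Build Q mulQA mul1Q mulQ1 mulVQ mulQV).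
pose g (j : 'I_n) : G := \pi_Q [:: (j, false)].
have morph i : exists2 phi : {multiplicative G -> K i},
    (forall q, phi q = ev i q) & forall w, phi (eval_word g w) = eval_word (a i) w.
  pose phiM := isMultiplicative.Build G (K i) (ev i) (ev_mul i).
  pose phi : {multiplicative G -> K i} := HB.pack (ev i : G -> K i) phiM.
  exists phi => // w; rewrite eval_word_morph; apply: eq_bigr => l _.
  by rewrite /eval_letter /= ev_pi eval_word_cons eval_word1 mulg1.
have ev_word w i : ev i (eval_word g w) = eval_word (a i) w.
  by have [phi phiE <-] := morph i.
exists G, g; split=> [q|w|i]; last by have [phi] := morph i; exists phi.
  by exists (generic_quotient.repr (q : Q)); apply: ev_inj => i; rewrite ev_word.
apply/eqP/idP=> [w1|/TP w1].
  by apply/TP => i; rewrite -ev_word w1; apply: ev_one.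
by apply: ev_inj => i; rewrite ev_word w1; apply/esym/ev_one.
Qed.

End ResidualGroup.

(** * Computable functions *)

(* The arity n makes weakening ([computable_behead]) definable, as a code has no
   operation that drops the first argument of a list of unknown length. *)
Definition computable n (f : seq nat -> nat) : Prop :=
  exists c : murec, forall v, size v = n -> computes c v (f v).

Section Computable.
Variable n : nat.
Implicit Types (f g m : seq nat -> nat) (b : seq nat -> bool).

Lemma computable_const k : computable n (fun=> k).
Proof.
elim: k => [|k [c kP]]; first by exists Mzero.
by exists (Mcomp Msucc [:: c]) => v /kP cv; exists [:: k].
Qed.

Lemma computable_nth i : computable n (fun v => nth 0 v i).
Proof. by exists (Mproj i). Qed.

Lemma computable_comp (gs : seq (seq nat -> nat)) f :
    (forall i, i < size gs -> computable n (nth (fun=> 0) gs i)) ->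
  computable (size gs) f -> computable n (fun v => f [seq g v |
    g : seq nat -> nat <- gs]).
Proof.
move=> gsP [c cP].
have [cs csP]: exists cs, forall v, size v = n ->
    args_graph computes cs v [seq g v | g : seq nat -> nat <- gs].
  elim: gs gsP {cP} => [|g gs IHgs] gsP; first by exists [::].
  have [//|cg cgP] := gsP 0; have [i lti|cs csP] := IHgs.
    exact: (gsP i.+1).
  by exists (cg :: cs) => v sz_v; split; [apply: cgP | apply: csP].
exists (Mcomp c cs) => v sz_v; exists [seq g v | g : seq nat -> nat <- gs].
  exact: csP.
by apply: cP; rewrite size_map.
Qed.

Lemma computable_comp1 F g :
  computable 1 F -> computable n g -> computable n (fun v => F [:: g v]).
Proof. by move=> FP gP; apply: (@computable_comp [:: g]) => // -[]. Qed.

Lemma computable_succ f : computable n f -> computable n (fun v => (f v).+1).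
Proof.
by apply: (@computable_comp1 (fun v => (head 0 v).+1)); exists Msucc.
Qed.

End Computable.

Lemma computable_eq n f g :
  (forall v, size v = n -> f v = g v) -> computable n f -> computable n g.
Proof. by move=> fg [c cP]; exists c => v sz_v; rewrite -fg //; apply: cP. Qed.

Lemma computable_behead n f :
  computable n f -> computable n.+1 (fun w => f (behead w)).
Proof.
move=> fP; pose gs := [seq (fun w : seq nat => nth 0 w i.+1) | i <- iota 0 n].
apply: computable_eq (_ : computable _ (fun w => f [seq g w |
  g : seq nat -> nat <- gs])).
  case=> [|x v] //= [sz_v]; rewrite -map_comp /=; congr f.
  by rewrite -[RHS](mkseq_nth 0) sz_v.
apply: computable_comp; rewrite size_map size_iota // => i lti.
by rewrite (nth_map 0) ?size_iota //; apply: computable_nth.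
Qed.

(** This is [Mprec]: the body receives the counter and the accumulator in front of the arguments,
    whence the arity [n.+2]. *)
Lemma computable_iteri n (f m : seq nat -> nat) (g : nat -> nat -> seq nat -> nat) :
    computable n m -> computable n f ->
    computable n.+2 (fun w => g (nth 0 w 0) (nth 0 (behead w) 0) (behead (behead w))) ->
  computable n (fun v => iteri (m v) (fun i z => g i z v) (f v)).
Proof.
move=> mP [cf cfP] [cg cgP].
have hP: computable n.+1 (fun w => iteri (nth 0 w 0) (fun i z =>
  g i z (behead w)) (f (behead w))).
  exists (Mprec cf cg) => -[|k v] //= [sz_v].
  elim: k => [|k IHk] /=; first exact: cfP.
  by exists (iteri k (fun i z => g i z v) (f v)) => //; apply: cgP; rewrite /= sz_v.
pose gs := m :: [seq (fun w : seq nat => nth 0 w i) | i <- iota 0 n].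
pose h w := iteri (nth 0 w 0) (fun i z => g i z (behead w)) (f (behead w)).
apply: computable_eq (_ : computable n (fun v => h [seq g v |
  g : seq nat -> nat <- gs])).
  move=> v sz_v; rewrite /h /gs /= -map_comp.
  suff ->: [seq ((fun g : seq nat -> nat => g v) \o (fun i w => nth 0 w i)) i |
    i <- iota 0 n] = v by [].
  by rewrite -[RHS](mkseq_nth 0) sz_v.
apply: computable_comp; rewrite /= size_map size_iota // => -[|i] //= lti.
by rewrite (nth_map 0) ?size_iota //; apply: computable_nth.
Qed.

Ltac computable_hyp := idtac; match goal with
  | H : computable _ _ |- _ =>
    first [ exact H | exact (computable_behead H)
          | exact (computable_behead (computable_behead H))
          | exact (computable_behead (computable_behead (computable_behead H))) ]
  end.

Ltac computable_var := idtac; lazymatch goal with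
  | |- computable _ (fun v => nth 0 v _) => exact (computable_nth _ _)
  | |- computable _ (fun v => nth 0 (@?w v) _) =>
  first [ exact (computable_behead (computable_nth _ _))
        | exact (computable_behead (computable_behead (computable_nth _ _)))
        | exact (computable_behead
                  (computable_behead (computable_behead (computable_nth _ _)))) ]
  end.

Ltac computable_base := idtac; lazymatch goal with
  | |- computable _ (fun=> ?k) => exact (computable_const _ k)
  | _ => first [ computable_var | computable_hyp ]
  end.

(** Follows the structure of the expression; [tac] supplies the rules for operations other than
    constants, variables, hypotheses and successor. *)
Ltac computable_with tac :=
  repeat (cbv beta; first [ computable_base | tac | apply: computable_succ ]).

(** * Arithmetic, tests and bounded quantifiers *)

Section Arithmetic.
Variables (n : nat) (f g : seq nat -> nat).
Hypotheses (fP : computable n f) (gP : computable n g).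

Lemma computable_add : computable n (fun v => f v + g v).
Proof.
apply: (@computable_eq _ (fun v => iteri (g v) (fun i z => z.+1) (f v))).
  by move=> v _; elim: (g v) => [|k IHk] /=; rewrite ?addn0 // IHk addnS.
by apply: computable_iteri; computable_with fail.
Qed.

Lemma computable_pred : computable n (fun v => (f v).-1).
Proof.
apply: (@computable_eq _ (fun v => iteri (f v) (fun i z => i) 0)).
  by move=> v _; case: (f v).
by apply: computable_iteri; computable_with fail.
Qed.

End Arithmetic.

Lemma computable_sub n f g :
  computable n f -> computable n g -> computable n (fun v => f v - g v).
Proof.
move=> fP gP; apply: (@computable_eq _ (fun v => iteri (g v) (fun i z => z.-1) (f v))).
  by move=> v _; elim: (g v) => [|k IHk] /=; rewrite ?subn0 // IHk subnS.
by apply: computable_iteri; computable_with ltac:(apply: computable_pred).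
Qed.

Lemma computable_mul n f g :
  computable n f -> computable n g -> computable n (fun v => f v * g v).
Proof.
move=> fP gP; apply: (@computable_eq _ (fun v => iteri (g v) (fun i z => z + f v) 0)).
  by move=> v _; elim: (g v) => [|k IHk] /=; rewrite ?muln0 // IHk mulnS addnC.
by apply: (@computable_iteri _ _ _ (fun i z v => z + f v));
  computable_with ltac:(apply: computable_add).
Qed.

Lemma computable_expn n f g :
  computable n f -> computable n g -> computable n (fun v => f v ^ g v).
Proof.
move=> fP gP; apply: (@computable_eq _ (fun v => iteri (g v) (fun i z => z * f v) 1)).
  by move=> v _; elim: (g v) => [|k IHk] //=; rewrite IHk expnSr.
by apply: (@computable_iteri _ _ _ (fun i z v => z * f v));
  computable_with ltac:(apply: computable_mul).
Qed.

Lemma computable_double n f : computable n f -> computable n (fun v => (f v).*2).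
Proof.
move=> fP; apply: (@computable_eq _ (fun v => f v + f v)) => [v _|]; first exact: addnn.
exact: computable_add.
Qed.

Lemma computable_fact n f : computable n f -> computable n (fun v => (f v)`!).
Proof.
move=> fP; apply: (@computable_eq _ (fun v => iteri (f v) (fun i z => i.+1 * z) 1)).
  by move=> v _; elim: (f v) => [|k IHk] //=; rewrite IHk factS.
by apply: computable_iteri; computable_with ltac:(apply: computable_mul).
Qed.

Lemma computable_iter n (f m : seq nat -> nat) (g : nat -> seq nat -> nat) :
    computable n m -> computable n f ->
    computable n.+2 (fun w => g (nth 0 (behead w) 0) (behead (behead w))) ->
  computable n (fun v => iter (m v) (g^~ v) (f v)).
Proof.
move=> mP fP gP; apply: (@computable_eq _ (fun v => iteri (m v) (fun=> g^~ v) (f v))).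
  by move=> v _; elim: (m v) => [|k IHk] //=; rewrite IHk.
exact: computable_iteri.
Qed.

Lemma computable_sum n (m : seq nat -> nat) (F : nat -> seq nat -> nat) :
    computable n m ->
    computable n.+1 (fun w => F (nth 0 w 0) (behead w)) ->
  computable n (fun v => \sum_(i < m v) F i v).
Proof.
move=> mP FP; apply: (@computable_eq _ (fun v => iteri (m v) (fun i z => z + F i v) 0)).
  by move=> v _; elim: (m v) => [|k IHk]; rewrite ?big_ord0 ?big_ord_recr //= IHk.
apply: (@computable_iteri _ _ _ (fun i z v => z + F i v)) => //.
  exact: computable_const.
(* The accumulator stands second among the arguments of the loop body and has to be skipped. *)
have {}FP : computable n.+2 (fun w => F (nth 0 w 0) (behead (behead w))).
  pose gs := (fun w : seq nat => nth 0 w 0) ::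
    [seq (fun w : seq nat => nth 0 w i.+2) | i <- iota 0 n].
  pose F1 w := F (nth 0 w 0) (behead w).
  apply: (@computable_eq _ (fun w => F1 [seq g w | g : seq nat -> nat <- gs])).
    case=> [|x [|y v]] //= [sz_v]; rewrite /F1 -map_comp /=; congr (F x).
    by rewrite -[RHS](mkseq_nth 0) sz_v.
  apply: computable_comp; rewrite /= size_map size_iota // => -[|i] lti.
    exact: computable_nth.
  by rewrite /= (nth_map 0) ?size_iota //; apply: computable_nth.
by computable_with ltac:(apply: computable_add).
Qed.

Section Booleans.
Variables (n : nat) (b b' : seq nat -> bool) (f g : seq nat -> nat).
Hypotheses (bP : computable n b) (b'P : computable n b').
Hypotheses (fP : computable n f) (gP : computable n g).

Lemma computable_negb : computable n (fun v => ~~ b v).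
Proof.
apply: (@computable_eq _ (fun v => 1 - b v)); first by move=> v _; case: (b v).
by computable_with ltac:(apply: computable_sub).
Qed.

Lemma computable_andb : computable n (fun v => b v && b' v).
Proof.
apply: (@computable_eq _ (fun v => b v * b' v)).
  by move=> v _; case: (b v); case: (b' v).
by computable_with ltac:(apply: computable_mul).
Qed.

Lemma computable_orb : computable n (fun v => b v || b' v).
Proof.
apply: (@computable_eq _ (fun v => 1 - (1 - b v) * (1 - b' v))).
  by move=> v _; case: (b v); case: (b' v).
by computable_with ltac:(first [apply: computable_sub | apply: computable_mul]).
Qed.

Lemma computable_leq : computable n (fun v => f v <= g v).
Proof.
apply: (@computable_eq _ (fun v => 1 - (f v - g v))).
  by move=> v _; rewrite -subn_eq0; case: (f v - g v).
by computable_with ltac:(apply: computable_sub).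
Qed.

Lemma computable_odd : computable n (fun v => odd (f v)).
Proof.
apply: (@computable_eq _ (fun v => iter (f v) (subn 1) 0)).
  by move=> v _; elim: (f v) => [|k IHk] //=; rewrite IHk; case: odd.
by apply: (@computable_iter _ _ _ (fun z _ => 1 - z));
  computable_with ltac:(apply: computable_sub).
Qed.

Lemma computable_if : computable n (fun v => if b v then f v else g v).
Proof.
apply: (@computable_eq _ (fun v => b v * f v + (1 - b v) * g v)).
  by move=> v _; case: (b v); rewrite ?mul1n ?mul0n ?addn0.
by computable_with ltac:(first [apply: computable_sub | apply: computable_mul |
  apply: computable_add]).
Qed.

End Booleans.

Lemma computable_eqn n f g : computable n f -> computable n g ->
  computable n (fun v => f v == g v).
Proof.
move=> fP gP; apply: (@computable_eq _ (fun v => (f v <= g v) && (g v <= f v))).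
  by move=> v _; rewrite eqn_leq.
by apply: computable_andb; apply: computable_leq.
Qed.

Lemma computable_all n (m : seq nat -> nat) (P : nat -> seq nat -> bool) :
    computable n m ->
    computable n.+1 (fun w => P (nth 0 w 0) (behead w)) ->
  computable n (fun v => all (P^~ v) (iota 0 (m v))).
Proof.
move=> mP PP; apply: (@computable_eq _ (fun v => \sum_(i < m v) ~~ P i v == 0)).
  move=> v _; rewrite sum_nat_eq0; congr (nat_of_bool _).
  apply/forallP/allP => [Pv i|Pv i].
    by rewrite mem_iota => lti; have := Pv (Ordinal lti); rewrite /= eqb0 negbK.
  by rewrite eqb0 negbK Pv // mem_iota ltn_ord.
apply: computable_eqn; last exact: computable_const.
by apply: (@computable_sum _ _ (fun i v => ~~ P i v)) => //; apply: computable_negb.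
Qed.

Ltac computable_arith := idtac; lazymatch goal with
  | |- computable _ (fun v => nat_of_bool (~~ @?a v)) => apply: computable_negb
  | |- computable _ (fun v => nat_of_bool (@?a v && @?b v)) => apply: computable_andb
  | |- computable _ (fun v => nat_of_bool (@?a v || @?b v)) => apply: computable_orb
  | |- computable _ (fun v => nat_of_bool (@eq_op _ (@?a v) (@?b v))) =>
    apply: computable_eqn
  | |- computable _ (fun v => nat_of_bool (@?a v <= @?b v)) => apply: computable_leq
  | |- computable _ (fun v => nat_of_bool (odd (@?a v))) => apply: computable_odd
  | |- computable _ (fun v => @?a v + @?b v) => apply: computable_add
  | |- computable _ (fun v => @?a v - @?b v) => apply: computable_sub
  | |- computable _ (fun v => @?a v * @?b v) => apply: computable_mul
  | |- computable _ (fun v => @?a v ^ @?b v) => apply: computable_expn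
  | |- computable _ (fun v => (@?a v)`!) => apply: computable_fact
  | |- computable _ (fun v => (@?a v).*2) => apply: computable_double
  | _ => apply: computable_if
  end.

Lemma computable_has n (m : seq nat -> nat) (P : nat -> seq nat -> bool) :
    computable n m ->
    computable n.+1 (fun w => P (nth 0 w 0) (behead w)) ->
  computable n (fun v => has (P^~ v) (iota 0 (m v))).
Proof.
move=> mP PP; apply: (@computable_eq _ (fun v => ~~ all (fun i =>
  ~~ P i v) (iota 0 (m v)))).
  by move=> v _; rewrite -has_predC; congr (nat_of_bool _); apply: eq_has => i;
    rewrite /= negbK.
apply: computable_negb; apply: (@computable_all _ _ (fun i v => ~~ P i v)) => //.
exact: computable_negb.
Qed.

(** Quotients, 2-adic valuations and lengths of coded lists are all obtained by counting an initial
    segment below a crude bound. *)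
Lemma sum_ltn n c : \sum_(i < n) (i < c) = minn n c.
Proof.
elim: n => [|n IHn]; first by rewrite big_ord0 min0n.
by rewrite big_ord_recr /= IHn; case: ltnP => nc; lia.
Qed.

Lemma computable_divn n f g :
  computable n f -> computable n g -> computable n (fun v => f v %/ g v).
Proof.
(* The guard [0 < g v] matches the convention that division by 0 gives 0. *)
move=> fP gP; apply: (@computable_eq _ (fun v =>
  \sum_(i < f v) ((0 < g v) && (i.+1 * g v <= f v)))).
  move=> v _; case: (posnP (g v)) => [-> | gt0]; first by rewrite divn0 big1.
  under eq_bigr => i _ do rewrite -leq_divRL //=.
  by rewrite sum_ltn; apply/minn_idPr/leq_div.
by apply: (@computable_sum _ _ (fun i v => (0 < g v) && (i.+1 * g v <= f v)));
  computable_with computable_arith.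
Qed.

Lemma computable_modn n f g :
  computable n f -> computable n g -> computable n (fun v => f v %% g v).
Proof.
move=> fP gP; apply: (@computable_eq _ (fun v => f v - f v %/ g v * g v)).
  by move=> v _; rewrite {1}(divn_eq (f v) (g v)) addKn.
by computable_with ltac:(first [apply: computable_divn | computable_arith]).
Qed.

Lemma computable_logn2 n f : computable n f -> computable n (fun v => logn 2 (f v)).
Proof.
move=> fP; apply: (@computable_eq _ (fun v =>
  \sum_(i < f v) (f v %% 2 ^ i.+1 == 0))).
  move=> v _; case: (posnP (f v)) => [->|gt0]; first by rewrite big_ord0.
  under eq_bigr => i _ do rewrite -/(_ %| _) pfactor_dvdn //=.
  by rewrite sum_ltn; apply/minn_idPr/ltnW/ltn_logl.
by apply: (@computable_sum _ _ (fun i v => f v %% 2 ^ i.+1 == 0));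
  computable_with ltac:(first [apply: computable_modn | computable_arith]).
Qed.

(* [CodeSeq.code (x :: s)] is [2 ^ x * (2 * CodeSeq.code s + 1)]. *)
Definition code_tail q := q %/ 2 ^ (logn 2 q).+1.
Definition code_drop j q := iter j code_tail q.
Definition code_nth j q := logn 2 (code_drop j q).
(** Counting up to [q] suffices, because a list is never longer than its code. *)
Definition code_size q := \sum_(j < q) (code_drop j q != 0).

Lemma computable_code_drop n f g : computable n f -> computable n g ->
  computable n (fun v => code_drop (f v) (g v)).
Proof.
move=> fP gP; apply: (@computable_iter _ _ _ (fun z _ => code_tail z)) => //.
by rewrite /code_tail;
  computable_with ltac:(first [apply: computable_divn |
  apply: computable_logn2 | computable_arith]).
Qed.

Lemma computable_code_nth n f g : computable n f -> computable n g ->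
  computable n (fun v => code_nth (f v) (g v)).
Proof. by move=> fP gP; apply/computable_logn2/computable_code_drop. Qed.

Lemma computable_code_size n f : computable n f ->
  computable n (fun v => code_size (f v)).
Proof.
move=> fP; apply: (@computable_sum _ _ (fun j v => code_drop j (f v) != 0)) => //.
by computable_with ltac:(first [apply: computable_code_drop | computable_arith]).
Qed.

Lemma logn_code x s : logn 2 (CodeSeq.code (x :: s)) = x.
Proof.
rewrite /= lognM ?expn_gt0 // pfactorK // lognE /= dvdn2 /= odd_double /=.
by rewrite addn0.
Qed.

Lemma code_tailE s : code_tail (CodeSeq.code s) = CodeSeq.code (behead s).
Proof.
case: s => [|x s]; first by [].
rewrite /code_tail logn_code /= expnSr divnMA mulKn ?expn_gt0 //.
by rewrite divn2 /= uphalf_double.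
Qed.

Lemma code_dropE j s : code_drop j (CodeSeq.code s) = CodeSeq.code (drop j s).
Proof.
elim: j => [|j IHj]; first by rewrite drop0.
by rewrite /code_drop iterS -/(code_drop _ _) IHj code_tailE -drop1 drop_drop add1n.
Qed.

Lemma code_nthE j s : code_nth j (CodeSeq.code s) = nth 0 s j.
Proof.
rewrite /code_nth code_dropE -[LHS]/(logn 2 _) -[j in RHS]addn0 -nth_drop.
(* Past the end the remaining code is 0, and [logn 2 0 = 0] agrees with the default of [nth]. *)
by case: (drop j s) => [|x s']; rewrite ?logn_code.
Qed.

Lemma code_eq0 s : (CodeSeq.code s == 0) = (s == [::]).
Proof. by case: s => //= x s; rewrite muln_eq0 expn_eq0. Qed.

Lemma size_leq_code s : size s <= CodeSeq.code s.
Proof.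
elim: s => //= x s IHs; have := ltn_expl x (ltnSn 1).
by rewrite -muln2; nia.
Qed.

Lemma code_sizeE s : code_size (CodeSeq.code s) = size s.
Proof.
rewrite -[RHS](minn_idPr (size_leq_code s)) -sum_ltn; apply: eq_bigr => j _.
by rewrite code_dropE code_eq0 -size_eq0 size_drop subn_eq0 -ltnNge.
Qed.

(** * The finite quotients and the word problem *)

(** Toggling and reading are involutions over F_2, so A and A^-1 act alike, and so do B and B^-1. *)
Definition toggles (l : nat -> nat) i := l i <= 1.
Definition reads (l : nat -> nat) i := (l i == 2) || (l i == 3).
(* The position of the head before the j-th letter, shifted by the length L of
   the word so as to be a natural number when j <= L. *)
Definition height (l : nat -> nat) L j :=
  L + \sum_(i < j) (l i == 4) - \sum_(i < j) (l i == 5).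
Definition toggle_count l L z :=
  \sum_(j < L) (toggles l j && (height l L j == z)).
Definition read_count l L z :=
  \sum_(j < L) (reads l j && (height l L j == z)).
(* Counts the pairs of a toggle followed by a read such that the toggle is at
   distance z - 2L from the read. *)
Definition pair_count l L z :=
  \sum_(j < L) \sum_(i < j)
    ((toggles l i && reads l j) && (height l L i + L.*2 == height l L j + z)).

(** In order: the head returns, the tape is restored, the register does not depend on the initial
    tape, and a dark tape adds nothing to it. Distances in S are exempt in the last test, as no
    admissible machine has them. Heights lie in [0, 2L] and shifted distances in [0, 4L]. *)
Definition trivial_word (S : pred nat) l L :=
  [&& height l L L == L,
      all (fun z => ~~ odd (toggle_count l L z)) (iota 0 L.*2.+1),
      all (fun z => ~~ odd (read_count l L z)) (iota 0 L.*2.+1) &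
      all (fun z => ((L.*2 <= z) && S (z - L.*2)) || ~~ odd (pair_count l L z))
          (iota 0 L.*2.*2.+1)].

Lemma sum_letter_le (l : nat -> nat) c j : \sum_(i < j) (l i == c) <= j.
Proof.
by rewrite -[leqRHS]card_ord -sum1_card leq_sum // => i _; apply: leq_b1.
Qed.

Lemma height_le l L j : j <= L -> height l L j <= L.*2.
Proof.
by have := sum_letter_le l 4 j; rewrite /height -addnn; lia.
Qed.

Section FiniteQuotients.
Local Open Scope ring_scope.

Lemma natrF2_eq0 n : (n%:R == 0 :> 'F_2) = ~~ odd n.
Proof. by rewrite -(dvdn_pcharf (pchar_Fp (isT : prime 2))) dvdn2. Qed.

Lemma natrZp_inj M m n : (1 < M)%N -> (m < M)%N -> (n < M)%N ->
  (m%:R == n%:R :> 'Z_M) = (m == n).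
Proof.
move=> M_gt1 ltm ltn.
by rewrite -(inj_eq val_inj) /= !val_Zp_nat // !modn_small.
Qed.

(** * The machine with tape Z/M and reading distance d *)

Section Machine.

Variables (M : nat) (d : 'Z_M).

Definition state : finType := ({ffun 'Z_M -> 'F_2} * 'F_2 * 'Z_M)%type.
Implicit Types (X : state) (x : {ffun 'Z_M -> 'F_2}) (y : 'F_2) (p : 'Z_M).

Definition toggle X : state :=
  let: (x, y, p) := X in ([ffun r => x r + (r == p)%:R], y, p).
Definition read X : state := let: (x, y, p) := X in (x, y + x (p + d), p).
Definition move z X : state := let: (x, y, p) := X in (x, y, p + z).

Lemma addF2K (a : 'F_2) : a + a = 0.
Proof. by have := addrr_pchar2 (pchar_Fp (isT : prime 2)) a. Qed.

Lemma toggleK : involutive toggle.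
Proof.
case=> [[x y] p]; congr (_, _, _); apply/ffunP=> r.
by rewrite !ffunE -addrA addF2K addr0.
Qed.

Lemma readK : involutive read.
Proof. by case=> [[x y] p] /=; rewrite -addrA addF2K addr0. Qed.

Lemma moveK z : cancel (move z) (move (- z)).
Proof. by case=> [[x y] p] /=; rewrite addrK. Qed.

Definition machine (i : 'I_3) : {perm state} :=
  if val i == 0 then perm (can_inj toggleK)
  else if val i == 1 then perm (can_inj readK) else perm (can_inj (moveK 1)).

Definition step c : state -> state :=
  if (c <= 1)%N then toggle else if (c == 2) || (c == 3) then read
  else if c == 4 then move 1 else if c == 5 then move (- 1) else id.

Definition run (l : nat -> nat) L X := iteri L (fun i => step (l i)) X.

Lemma permV_eq (f g : state -> state) (fK : cancel f g) X :
  cancel g f -> (perm (can_inj fK))^-1%g X = g X.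
Proof. by move=> gK; apply: (canLR (permK _)); rewrite permE gK. Qed.

Lemma machine_letterE (lt : letter 3) X :
  eval_letter machine lt X = step (letter_code lt) X.
Proof.
case: lt => [[[|[|[|i]]] lti] []] //=; rewrite /eval_letter /machine /step /=;
  first [rewrite permV_eq // | rewrite permE //]; try exact: toggleK; try exact: readK.
by move=> Y; rewrite -{1}[1]opprK moveK.
Qed.

(** Products of permutations act from left to right, so the first letter of a word acts first. *)
Lemma machine_wordE (w : word 3) X :
  eval_word machine w X = foldl (fun X c => step c X) X (word_code w).
Proof.
elim: w X => [|lt w IHw] X /=; first by rewrite eval_word1 perm1.
by rewrite eval_word_cons permM IHw machine_letterE.
Qed.

Lemma eq_run l l' L X : (forall i, i < L -> l i = l' i)%N -> run l L X = run l' L X.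
Proof.
rewrite /run; elim: L => //= L IHL eq_l; rewrite eq_l // IHL // => i ltiL.
by rewrite eq_l // ltnW.
Qed.

Lemma run_foldl s X : run (nth 0%N s) (size s) X = foldl (fun X c => step c X) X s.
Proof.
elim/last_ind: s => //= s c IHs; rewrite foldl_rcons size_rcons -IHs.
rewrite {1}/run /= nth_rcons ltnn eqxx; congr step.
by apply: eq_run => i lti; rewrite nth_rcons lti.
Qed.

Section Run.
Variable l : nat -> nat.

Definition offset j : 'Z_M :=
  \sum_(i < j) ((l i == 4)%:R - (l i == 5)%:R).

Lemma offsetE L j : (j <= L)%N -> offset j = (height l L j)%:R - L%:R.
Proof.
move=> lejL; rewrite /height natrB.
  by rewrite natrD addrAC [L%:R + _]addrC addrK /offset sumrB !natr_sum.
(* The subtraction in [height] is not truncated: at most j <= L letters are T^-1. *)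
by apply: leq_trans (leq_addr _ _); apply: leq_trans lejL; apply: sum_letter_le.
Qed.

Definition toggled L (q : 'Z_M) : 'F_2 :=
  \sum_(j < L) (toggles l j && (offset j == q))%:R.
Definition read_sum x p L : 'F_2 :=
  \sum_(j < L) (reads l j)%:R * x (p + offset j + d).
Definition pair_sum L : 'F_2 :=
  \sum_(j < L) \sum_(i < j)
    ((toggles l i && reads l j) && (offset i == offset j + d))%:R.

Lemma pair_sumS L :
  pair_sum L.+1 = pair_sum L + (reads l L)%:R * toggled L (offset L + d).
Proof.
rewrite /pair_sum big_ord_recr mulr_sumr; congr (_ + _); apply: eq_bigr => i _ /=.
by case: (reads l L); rewrite ?mul1r ?mul0r ?andbT ?andbF.
Qed.

(** A read sees the initial lamp plus its earlier toggles. This splits the change of the register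
    into [read_sum], linear in the initial tape, and [pair_sum], independent of it. *)
Lemma runE L x y p :
  run l L (x, y, p) =
    ([ffun r => x r + toggled L (r - p)], y + read_sum x p L + pair_sum L,
     p + offset L).
Proof.
rewrite /run; elim: L => [|L IHL] /=.
  rewrite /offset /read_sum /pair_sum !big_ord0 !addr0; congr (_, _, _).
  by apply/ffunP=> r; rewrite ffunE /toggled big_ord0 addr0.
rewrite {}IHL pair_sumS /read_sum /toggled /offset !big_ord_recr /=.
rewrite -/(offset L) -/(read_sum x p L) -/(toggled L _).
have tapeS r : x r + \sum_(j < L.+1) (toggles l j && (offset j == r - p))%:R =
    x r + toggled L (r - p) + (toggles l L && (r == p + offset L))%:R.
  by rewrite big_ord_recr /= addrA [offset L == _]eq_sym subr_eq [offset L + p]addrC.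
have ->: [ffun r => x r + \sum_(j < L.+1) (toggles l j && (offset j == r - p))%:R] =
    [ffun r => x r + toggled L (r - p) + (toggles l L && (r == p + offset L))%:R].
  by apply/ffunP=> r; rewrite !ffunE tapeS.
have ffD0 : [ffun r => x r + toggled L (r - p) + 0] = [ffun r =>
  x r + toggled L (r - p)].
  by apply/ffunP=> r; rewrite !ffunE addr0.
rewrite /step /toggles /reads {tapeS}.
case: (l L) => [|[|[|[|[|[|c]]]]]];
  rewrite /= ?ffD0 ?subr0 ?sub0r ?mul1r ?mul0r ?addr0 ?addrA //.
(* These are the two toggling letters; the goals left after them are the two reading letters. *)
1,2: by congr (_, _, _); apply/ffunP=> r; rewrite !ffunE.
all: rewrite ffunE addrA; congr (_, _, _).
all: rewrite (_ : p + offset L + d - p = offset L + d); last by ring.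
all: by rewrite -/(toggled L _); congr (_ + _); rewrite addrAC.
Qed.

End Run.
End Machine.

(** Grouping positions by the value of [k], such as their height, turns a sum along the run into a
    combination of the counts whose parities [trivial_word] tests. *)
Lemma sum_fiber (c : nat -> bool) (k : nat -> nat) (h : nat -> 'F_2) L B :
    (forall j, j < L -> k j < B)%N ->
  \sum_(j < L) (c j)%:R * h (k j) =
  \sum_(z < B) h z * (\sum_(j < L) (c j && (k j == z)))%:R.
Proof.
move=> kB; under [RHS]eq_bigr => z _ do rewrite natr_sum mulr_sumr.
rewrite exchange_big; apply: eq_bigr => j _ /=.
rewrite (bigD1 (Ordinal (kB _ (ltn_ord j)))) //= eqxx andbT big1 ?addr0 1?mulrC //.
by move=> z; rewrite -val_eqE /= eq_sym => /negPf->; rewrite andbF mulr0.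
Qed.

Lemma sum_fiber2 (c : nat -> nat -> bool) (k : nat -> nat -> nat) (h : nat ->
  'F_2) L B :
    (forall j i, i < j -> j < L -> k j i < B)%N ->
  \sum_(j < L) \sum_(i < j) (c j i)%:R * h (k j i) =
  \sum_(z < B) h z * (\sum_(j < L) \sum_(i < j) (c j i && (k j i == z)))%:R.
Proof.
move=> kB; under [RHS]eq_bigr => z _ do rewrite natr_sum mulr_sumr.
rewrite exchange_big; apply: eq_bigr => j _ /=; apply: sum_fiber => i ltij.
exact: kB.
Qed.

(* The integer z - N has to be separated from S, modulo arbitrarily large M. *)
Definition closed_mod (S : pred nat) := forall N z B,
  ~~ ((N <= z) && S (z - N))%N ->
  exists2 M, (B < M)%N & forall a, S a -> a + N != z %[mod M].

(** * Words that are trivial in all admissible machines *)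

Section Trivial.
Variables (S : pred nat) (l : nat -> nat) (L : nat).

Lemma toggledE M (q : 'Z_M) : toggled l L q =
  \sum_(z < L.*2.+1) (z%:R == q + L%:R)%:R * (toggle_count l L z)%:R.
Proof.
rewrite -(@sum_fiber (toggles l) (height l L) (fun z =>
  (z%:R == q + L%:R)%:R)); last first.
  by move=> j /ltnW; apply: height_le.
apply: eq_bigr => j _; rewrite (@offsetE _ l L) 1?ltnW // subr_eq.
by case: toggles; rewrite ?mul1r ?mul0r.
Qed.

Lemma read_sumE M (d : 'Z_M) x p : read_sum d l x p L =
  \sum_(z < L.*2.+1) x (p + (z%:R - L%:R) + d) * (read_count l L z)%:R.
Proof.
rewrite -(@sum_fiber (reads l) (height l L) (fun z =>
  x (p + (z%:R - L%:R) + d))); last first.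
  by move=> j /ltnW; apply: height_le.
by apply: eq_bigr => j _; rewrite (@offsetE _ l L) // ltnW.
Qed.

Lemma pair_sumE M (d : 'Z_M) : pair_sum d l L =
  \sum_(z < L.*2.*2.+1) (z%:R == d + L.*2%:R)%:R * (pair_count l L z)%:R.
Proof.
(* Heights are at most 2L, so adding 2L keeps the difference nonnegative. *)
pose k j i := (height l L i + L.*2 - height l L j)%N.
have kE j i z : (j < L)%N ->
    (height l L i + L.*2 == height l L j + z)%N = (k j i == z).
  by move=> /ltnW /(height_le l); rewrite /k; lia.
pose c j i := toggles l i && reads l j.
transitivity (\sum_(j < L) \sum_(i < j)
  (c j i)%:R * (((k j i)%:R == d + L.*2%:R)%:R : 'F_2)).
  apply: eq_bigr => j _; apply: eq_bigr => i _; rewrite -/(c j i).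
  have ltij := ltn_ord i; have ltjL := ltn_ord j.
  have hj := height_le l (ltnW ltjL).
  rewrite !(@offsetE _ l L) 1?ltnW // ?(ltn_trans ltij) //.
  rewrite /k (@natrB _ (height l L i + L.*2)); last by lia.
  rewrite natrD !subr_eq; case: (c j i); rewrite ?mul1r ?mul0r //=.
  congr ((_ : bool)%:R); rewrite -subr_eq0 -[RHS]subr_eq0; congr (_ == 0).
  by ring.
rewrite (@sum_fiber2 _ k (fun z => (z%:R == d + L.*2%:R)%:R) _ L.*2.*2.+1).
  apply: eq_bigr => z _; congr (_ * _%:R); apply: eq_bigr => j _.
  by apply: eq_bigr => i _; rewrite kE.
move=> j i ltij ltj; have := height_le l (ltnW (ltn_trans ltij ltj)).
by rewrite /k; lia.
Qed.

Lemma trivial_word_run : trivial_word S l L ->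
  forall M (d : 'Z_M), (forall a, S a -> a%:R != d) ->
  forall X, run d l L X = X.
Proof.
case/and4P=> /eqP heightL /allP togP /allP readP /allP pairP M d Sd [[x y] p].
have in_iota z B : (z < B)%N -> z \in iota 0 B by rewrite mem_iota.
rewrite runE (@offsetE _ l L) // heightL subrr addr0.
have ->: read_sum d l x p L = 0.
  rewrite read_sumE big1 // => z _; move/in_iota/readP: (ltn_ord z).
  by rewrite -natrF2_eq0 => /eqP->; rewrite mulr0.
have ->: pair_sum d l L = 0.
  rewrite pair_sumE big1 // => z _; move/in_iota/pairP: (ltn_ord z).
  (* A distance in S contributes nothing because d is not its residue; any other distance has an
     even count. *)
  case/orP=> [/andP[le_z Sz]|]; last by rewrite -natrF2_eq0 => /eqP->; rewrite mulr0.
  by move: (Sd _ Sz); rewrite natrB // subr_eq => /negPf->; rewrite mul0r.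
rewrite !addr0; congr (_, _, _); apply/ffunP=> r;
  rewrite ffunE toggledE big1 ?addr0 // => z _.
move/in_iota/togP: (ltn_ord z).
by rewrite -natrF2_eq0 => /eqP->; rewrite mulr0.
Qed.

(** Each condition is read off from the run of one well-chosen state, in a machine whose modulus is
    too large to confuse two heights or two distances. *)
Lemma run_trivial_word : closed_mod S ->
  (forall M (d : 'Z_M), (forall a, S a -> a%:R != d) ->
   forall X, run d l L X = X) -> trivial_word S l L.
Proof.
move=> clS runP.
(* An integer z - N outside S is the reading distance of an admissible machine of large modulus. *)
have ex_mod z N : ~~ ((N <= z)%N && S (z - N)%N) ->
  exists2 M, ((L + z).*2.*2.*2.+1 < M)%N &
    forall X, run (z%:R - N%:R : 'Z_M) l L X = X.
  move=> Sz; have [M ltM MP] := clS N z ((L + z).*2.*2.*2.+1) Sz.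
  exists M => //.
  apply: runP => a /MP; apply: contra.
  rewrite eq_sym subr_eq -natrD => /eqP/(congr1 val) /=.
  by rewrite !val_Zp_nat 1?eq_sym; [move/eqP | lia..].
have sum_delta M B k (c : nat -> 'F_2) : (k < B)%N -> (B < M)%N ->
    \sum_(z < B) (z%:R == k%:R :> 'Z_M)%:R * c z = c k.
  move=> ltk ltBM.
  rewrite (bigD1 (Ordinal ltk)) //= eqxx mul1r big1 ?addr0 //.
  move=> z; rewrite -val_eqE /= => nzk; have ltz := ltn_ord z.
  by rewrite natrZp_inj ?(negPf nzk) ?mul0r //; lia.
(* The integer 0 - 1 is negative, hence never in S: an admissible machine exists whatever S is. *)
have [M ltM] := ex_mod 0%N 1%N isT; move: (0%:R - 1%:R) => d runM.
have leL := height_le l (leqnn L).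
apply/and4P; split.
- have := congr1 snd (runM (0, 0, 0));
  rewrite runE /= add0r (@offsetE _ l L) // => /eqP.
  by rewrite subr_eq0 natrZp_inj //; lia.
- apply/allP => z; rewrite mem_iota add0n => /andP[_ ltz].
  have := congr1 (fun X : state M => X.1.1 (z%:R - L%:R)) (runM (0, 0, 0)).
  rewrite runE /= !ffunE subr0 add0r toggledE subrK (sum_delta M _ z (fun z =>
    (toggle_count l L z)%:R)); [|lia|lia].
  by move/eqP; rewrite natrF2_eq0.
- apply/allP => z; rewrite mem_iota add0n => /andP[_ ltz].
  (* The only lit lamp is the one read from height z; comparison with the dark tape isolates the
     reads made there. *)
  pose x : {ffun 'Z_M -> 'F_2} := [ffun q => (q == z%:R - L%:R + d)%:R].
  have := congr1 (fun X : state M => X.1.2) (runM (x, 0, 0)).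
  have := congr1 (fun X : state M => X.1.2) (runM (0, 0, 0)).
  rewrite !runE /= !add0r read_sumE big1 => [|i _]; last by rewrite ffunE mul0r.
  rewrite add0r => ->; rewrite addr0 read_sumE.
  have eq_x (i : 'I_L.*2.+1) : x (0 + (i%:R - L%:R) + d) = (i%:R == z%:R :> 'Z_M)%:R.
    rewrite ffunE -subr_eq0 -[in RHS]subr_eq0; congr ((_ == 0) : bool)%:R.
    by ring.
  under eq_bigr => i _ do rewrite eq_x.
  by rewrite (sum_delta M _ z (fun z => (read_count l L z)%:R)); [move/eqP;
    rewrite natrF2_eq0 | lia | lia].
- apply/allP => z; rewrite mem_iota add0n => /andP[_ ltz].
  (* On the dark tape only pairs reach the register, and the machine of reading distance z - 2L
     keeps just those counted at z. *)
  case: (boolP (_ && _)) => //= /ex_mod[M' ltM' runM'].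
  have := congr1 (fun X : state M' => X.1.2) (runM' (0, 0, 0)).
  rewrite runE /= add0r pair_sumE subrK (sum_delta M' _ z (fun z =>
    (pair_count l L z)%:R)); [|lia|lia].
  rewrite read_sumE big1 ?add0r => [/eqP|i _]; first by rewrite natrF2_eq0.
  by rewrite ffunE mul0r.
Qed.

End Trivial.

End FiniteQuotients.

(** * The diagonal set *)

(* The number s codes a list whose head is the degree k minus 1 and whose tail is
   the table of an action on [0, k): the letter c sends x to the entry of index
   c * k + x, reduced modulo k. *)
Definition degree s := (code_nth 0 s).+1.
Definition table_step s x c := code_nth (c * degree s + x) (code_tail s) %% degree s.
(** The code [r] bounds the length of its list; the rounds past the end do nothing. *)
Definition table_act s r x :=
  iteri r (fun j y =>
    if code_drop j r == 0 then y else table_step s y (code_nth j r)) x.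
Definition table_pow s m c x := iter m (fun y => table_step s y c) x.
Definition table_comm s m x :=
  table_step s (table_pow s m 5 (table_step s (table_pow s m 4
    (table_step s (table_pow s m 5 (table_step s (table_pow s m 4 x) 0)) 2)) 1)) 3.
(** The commutator of T^m A T^-m with B. *)
Definition comm_word m : seq nat :=
  nseq m 4 ++ 0 :: nseq m 5 ++ 2 :: nseq m 4 ++ 1 :: nseq m 5 ++ [:: 3].

(** The number [e] bounds its own count of relators; indices past the last one give the empty
    relator, which always holds. *)
Definition witness e s :=
  all (fun i => all (fun x => table_act s (code_nth i e) x == x) (iota 0 (degree s)))
      (iota 0 e)
  && (table_comm s e`! 0 != 0).
Definition first_witness e s :=
  witness e s && all (fun s' => ~~ witness e s') (iota 0 s).
(* 0 is the only limit point of the other elements in the profinite topology. *)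
Definition killed a := (a == 0) ||
  has (fun e => has (fun s => (a == e`! + (e + s + 2)`!) && first_witness e s)
                    (iota 0 a)) (iota 0 a).

(** * Computability of the diagonal set and of the word problem *)

Ltac computable_code := idtac; first
  [ apply: computable_divn | apply: computable_modn | apply: computable_logn2
  | apply: computable_code_drop | apply: computable_code_nth
  | apply: computable_code_size | computable_arith ].

Section ComputableWitness.
Variables (n : nat).
Implicit Types (e s x c m r a : seq nat -> nat).

Lemma computable_degree s : computable n s -> computable n (fun v => degree (s v)).
Proof. by move=> sP; rewrite /degree; computable_with computable_code. Qed.

Lemma computable_code_tail s : computable n s -> computable n (fun v =>
  code_tail (s v)).
Proof. by move=> sP; rewrite /code_tail; computable_with computable_code. Qed.

End ComputableWitness.

Lemma computable_table_step n s x c :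
    computable n s -> computable n x -> computable n c ->
  computable n (fun v => table_step (s v) (x v) (c v)).
Proof.
move=> sP xP cP; rewrite /table_step; computable_with ltac:(first
  [apply: computable_degree | apply: computable_code_tail | computable_code]).
Qed.

Lemma computable_table_act n s r x :
    computable n s -> computable n r -> computable n x ->
  computable n (fun v => table_act (s v) (r v) (x v)).
Proof.
move=> sP rP xP; apply: (@computable_iteri _ _ _ (fun j y v =>
  if code_drop j (r v) == 0 then y else table_step (s v) y (code_nth j (r v)))) => //.
computable_with ltac:(first [apply: computable_table_step | computable_code]).
Qed.

Lemma computable_table_pow n s m c x :
    computable n s -> computable n m -> computable n c -> computable n x ->
  computable n (fun v => table_pow (s v) (m v) (c v) (x v)).
Proof.
move=> sP mP cP xP.
apply: (@computable_iter _ _ _ (fun y v => table_step (s v) y (c v))) => //.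
computable_with ltac:(apply: computable_table_step).
Qed.

Lemma computable_witness n e s : computable n e -> computable n s ->
  computable n (fun v => witness (e v) (s v)).
Proof.
move=> eP sP; apply: computable_andb.
  apply: (@computable_all _ _ (fun i v => all (fun x =>
    table_act (s v) (code_nth i (e v)) x == x) (iota 0 (degree (s v))))) => //.
  apply: (@computable_all _ _ (fun x w =>
    table_act (s (behead w)) (code_nth (nth 0 w 0) (e (behead w))) x == x)).
    by computable_with ltac:(apply: computable_degree).
  by computable_with ltac:(first [apply: computable_table_act | computable_code]).
by rewrite /table_comm; computable_with ltac:(first
  [apply: computable_table_step | apply: computable_table_pow | computable_arith]).
Qed.

Lemma computable_first_witness n e s : computable n e -> computable n s ->
  computable n (fun v => first_witness (e v) (s v)).
Proof.
move=> eP sP; apply: computable_andb; first exact: computable_witness.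
apply: (@computable_all _ _ (fun s' v => ~~ witness (e v) s')) => //.
by computable_with ltac:(first [apply: computable_witness | computable_arith]).
Qed.

Lemma computable_killed n a : computable n a ->
  computable n (fun v => killed (a v)).
Proof.
move=> aP; apply: computable_orb; first by computable_with computable_arith.
apply: (@computable_has _ _ (fun e v => has (fun s =>
  (a v == e`! + (e + s + 2)`!) && first_witness e s) (iota 0 (a v)))) => //.
apply: (@computable_has _ _ (fun s w =>
  (a (behead w) == (nth 0 w 0)`! + (nth 0 w 0 + s + 2)`!)
   && first_witness (nth 0 w 0) s)); first by computable_with fail.
by computable_with ltac:(first [apply: computable_first_witness | computable_arith]).
Qed.

Lemma computable_height n (l : nat -> seq nat -> nat) L j :
    computable n.+1 (fun w => l (nth 0 w 0) (behead w)) ->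
    computable n L -> computable n j ->
  computable n (fun v => height (l^~ v) (L v) (j v)).
Proof.
move=> lP LP jP; rewrite /height; apply: computable_sub.
  apply: computable_add => //.
  apply: (@computable_sum _ _ (fun i v => l i v == 4)) => //.
  by computable_with computable_arith.
apply: (@computable_sum _ _ (fun i v => l i v == 5)) => //.
by computable_with computable_arith.
Qed.

Lemma computable_trivial_word n (q : seq nat -> nat) : computable n q ->
  computable n (fun v => trivial_word killed (code_nth^~ (q v)) (code_size (q v))).
Proof.
move=> qP.
have heightP k (Q j : seq nat -> nat) : computable k Q -> computable k j ->
    computable k (fun v => height (code_nth^~ (Q v)) (code_size (Q v)) (j v)).
  move=> QP jP; apply: (@computable_height _ (fun i v => code_nth i (Q v))) => //;
  by computable_with computable_code.
have lettersP k (b : (nat -> nat) -> nat -> bool) (Q z : seq nat -> nat) :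
    computable k Q -> computable k z ->
    (forall k' Q' i, computable k' Q' -> computable k' i ->
      computable k' (fun v => b (code_nth^~ (Q' v)) (i v))) ->
    computable k (fun v => \sum_(j < code_size (Q v))
      (b (code_nth^~ (Q v)) j &&
        (height (code_nth^~ (Q v)) (code_size (Q v)) j == z v))).
  move=> QP zP bP; apply: (@computable_sum _ _ (fun j v =>
    b (code_nth^~ (Q v)) j && (height (code_nth^~ (Q v)) (code_size (Q v)) j == z v))).
    exact: computable_code_size.
  by computable_with ltac:(first [apply: bP | apply: heightP | computable_arith]).
have togglesP k Q i : computable k Q -> computable k i ->
      computable k (fun v => toggles (code_nth^~ (Q v)) (i v)).
  by move=> QP iP; rewrite /toggles; computable_with computable_code.
have readsP k Q i : computable k Q -> computable k i ->
      computable k (fun v => reads (code_nth^~ (Q v)) (i v)).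
  by move=> QP iP; rewrite /reads; computable_with computable_code.
have pairsP k (Q z : seq nat -> nat) : computable k Q -> computable k z ->
    computable k (fun v => pair_count (code_nth^~ (Q v)) (code_size (Q v)) (z v)).
  move=> QP zP; pose F j i Q z := toggles (code_nth^~ Q) i && reads (code_nth^~ Q) j &&
    (height (code_nth^~ Q) (code_size Q) i + (code_size Q).*2 ==
     height (code_nth^~ Q) (code_size Q) j + z).
  apply: (@computable_sum _ _ (fun j v => \sum_(i < j) F j i (Q v) (z v))).
    exact: computable_code_size.
  apply: (@computable_sum _ _ (fun i w =>
    F (nth 0 w 0) i (Q (behead w)) (z (behead w)))).
    by computable_with fail.
  rewrite /F; computable_with ltac:(first
    [apply: togglesP | apply: readsP | apply: heightP | computable_code]).
rewrite /trivial_word; apply: computable_andb.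
  by computable_with ltac:(first [apply: heightP | computable_code]).
apply: computable_andb.
  apply: (@computable_all _ _ (fun z v =>
    ~~ odd (toggle_count (code_nth^~ (q v)) (code_size (q v)) z))).
    by computable_with computable_code.
  apply/computable_negb/computable_odd/lettersP => //; by computable_with fail.
apply: computable_andb.
  apply: (@computable_all _ _ (fun z v =>
    ~~ odd (read_count (code_nth^~ (q v)) (code_size (q v)) z))).
    by computable_with computable_code.
  apply/computable_negb/computable_odd/lettersP => //; by computable_with fail.
apply: (@computable_all _ _ (fun z v =>
  ((code_size (q v)).*2 <= z) && killed (z - (code_size (q v)).*2)
  || ~~ odd (pair_count (code_nth^~ (q v)) (code_size (q v)) z))).
  by computable_with computable_code.
by computable_with ltac:(first [apply: computable_killed | apply: pairsP |
  computable_code]).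
Qed.

(** * The diagonal set in the profinite topology *)

Lemma killedP a : reflect
  (a = 0 \/ exists e s, a = e`! + (e + s + 2)`! /\ first_witness e s) (killed a).
Proof.
apply: (iffP orP) => [[/eqP|/hasP[e _ /hasP[s _ /andP[/eqP aE fw]]]] |
  [->|[e [s [aE fw]]]]].
- by left.
- by right; exists e, s.
- by left.
(* Searching below a loses nothing, since e and s are less than (e + s + 2)!. *)
right; have := fact_geq (e + s + 2) => le_f; have := fact_gt0 e => f_gt0.
apply/hasP; exists e; first by rewrite mem_iota aE; lia.
by apply/hasP; exists s; [rewrite mem_iota aE; lia | rewrite aE eqxx].
Qed.

Lemma first_witness_unique e s s' :
  first_witness e s -> first_witness e s' -> s = s'.
Proof.
move=> /andP[ws /allP min_s] /andP[ws' /allP min_s']; apply/eqP.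
have := min_s s'; have := min_s' s; rewrite !mem_iota ws ws' /=.
by case: ltngtP => // _ Hs Hs'; [have := Hs isT | have := Hs' isT].
Qed.

(** Put n = e' + s + 2. An equation e! = e'! + n! forces n < e, and then e! >= (n + 1)! >= 3 n!,
    which exceeds e'! + n!. *)
Lemma fact_notin_killed e : ~~ killed e`!.
Proof.
apply/killedP => -[/eqP|[e' [s [eE _]]]]; first by rewrite -leqn0 leqNgt fact_gt0.
set n := e' + s + 2 in eE; have f_gt0 := fact_gt0 e'.
have lt_n: n < e by rewrite ltnNge; apply/negP => /leq_fact; rewrite eE; lia.
have le1 : n.+1`! <= e`! by apply: leq_fact.
have le2 : e'`! <= n`! by apply: leq_fact; lia.
have le3 : 3 * n`! <= n.+1`! by rewrite factS leq_mul2r ltnS /n addn2 orbT.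
by have := fact_gt0 n; move: le1 le3; rewrite eE; lia.
Qed.

Lemma dvdn_fact2 m n : m <= n -> m`! %| n`!.
Proof. by move=> /fact_split->; apply: dvdn_mulr. Qed.

(** Let D = z + N. The finitely many points with e <= D are separated by size, the others by their
    divisibility by (D + 1)!; the modulus is a large multiple of that factorial. *)
Lemma closed_mod_killed : closed_mod killed.
Proof.
move=> N z B nkilled; set D := z + N.
(* Each e has at most one first witness. Whether it has one is settled by classical logic, so the
   bound K need not be computable. *)
have [K KP]: exists K, forall e s, e <= D -> first_witness e s ->
    e`! + (e + s + 2)`! <= K.
  elim: {nkilled} D => [|D [K KP]].
    case: (classic (exists s, first_witness 0 s)) => [[s sP]|no_s].
      exists (0`! + (0 + s + 2)`!) => e s' /[!leqn0]/eqP-> s'P.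
      by rewrite (first_witness_unique sP s'P).
    by exists 0 => e s /[!leqn0]/eqP-> sP; case: no_s; exists s.
  case: (classic (exists s, first_witness D.+1 s)) => [[s sP]|no_s].
    exists (K + (D.+1`! + (D.+1 + s + 2)`!)) => e s'; rewrite leq_eqVlt ltnS.
    case/orP=> [/eqP-> s'P|le_e /(KP _ _ le_e)]; last by lia.
    by rewrite (first_witness_unique sP s'P) leq_addl.
  exists K => e s'; rewrite leq_eqVlt ltnS.
  by case/orP=> [/eqP-> s'P|le_e /(KP _ _ le_e)//]; case: no_s; exists s'.
pose M := D.+1`! * (K + D + B).+2.
have ltM : K + D + B < M by rewrite /M; have := fact_gt0 D.+1; nia.
have eq_killed a : killed a -> a + N < M -> a + N = z %[mod M] -> False.
  move=> ka lt_a; rewrite !modn_small //; last by lia.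
  by move=> zE; move: nkilled; rewrite -zE leq_addl addnK ka.
exists M => [|a ka]; first by lia.
apply/negP => /eqP eq_a; have := ka; case/killedP=> [a0|[e [s [aE fw]]]].
  by apply: (eq_killed a ka) => //; lia.
case: (leqP e D) => [/KP/(_ fw)|lt_e].
  by rewrite -aE => leK; apply: (eq_killed a ka) => //; lia.
(* Here (D + 1)! divides a, so N and z agree modulo it and, being smaller, are equal. But z - N = 0
   is in the set. *)
apply: (eq_killed 0) => //; first by lia.
have dvd_a : D.+1`! %| a by rewrite aE dvdn_add // dvdn_fact2 //; lia.
have : N = z %[mod D.+1`!].
  have : a + N = z %[mod D.+1`!].
    by rewrite -[LHS](@modn_dvdm M) ?eq_a ?modn_dvdm // dvdn_mulr.
  by rewrite -modnDml (eqP dvd_a) add0n.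
have := fact_geq D.+1; rewrite add0n => ltf; rewrite !modn_small; lia.
Qed.

(** * Coded actions and finite groups *)

Lemma table_actE s r x :
  table_act s (CodeSeq.code r) x = foldl (table_step s) x r.
Proof.
suff foldlE N : iteri N (fun j y => if code_drop j (CodeSeq.code r) == 0 then y
    else table_step s y (code_nth j (CodeSeq.code r))) x
  = foldl (table_step s) x (take N r).
  by rewrite /table_act foldlE take_oversize // size_leq_code.
elim: N => [|N IHN] /=; first by rewrite take0.
rewrite {}IHN code_dropE code_nthE code_eq0 -size_eq0 size_drop subn_eq0.
case: leqP => [le_r|lt_r];
  first by rewrite (take_oversize le_r) (take_oversize (leqW le_r)).
by rewrite (take_nth 0) // foldl_rcons.
Qed.

Lemma foldl_nseq (T : Type) (f : T -> nat -> T) m c x :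
  foldl f x (nseq m c) = iter m (f^~ c) x.
Proof. by elim: m x => //= m IHm x; rewrite IHm -iterSr. Qed.

Lemma table_commE s m x :
  table_comm s m x = foldl (table_step s) x (comm_word m).
Proof. by rewrite /comm_word; do 4 rewrite foldl_cat foldl_nseq /=. Qed.

Lemma code_seqsE (D : seq (seq nat)) i :
  code_nth i (CodeSeq.code (map CodeSeq.code D)) = CodeSeq.code (nth [::] D i).
Proof.
rewrite code_nthE; case: (ltnP i (size D)) => [lti|lei];
  first by rewrite (nth_map [::]).
by rewrite !nth_default // size_map.
Qed.

Lemma table_step_lt s x c : table_step s x c < degree s.
Proof. by rewrite ltn_pmod. Qed.

Lemma witnessP (D : seq (seq nat)) s :
  let e := CodeSeq.code (map CodeSeq.code D) in
  reflect ((forall r x, r \in D -> x < degree s -> foldl (table_step s) x r = x) /\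
           foldl (table_step s) 0 (comm_word e`!) <> 0) (witness e s).
Proof.
move=> e; rewrite /witness table_commE; apply: (iffP andP) => -[rel_ok mv];
  split; try exact/eqP.
  move=> r x; rewrite -index_mem => ltr ltx.
  have lti : index r D < e.
    by apply: leq_trans ltr _; rewrite -(size_map CodeSeq.code) size_leq_code.
  move/allP/(_ (index r D)): rel_ok; rewrite mem_iota lti => /(_ isT)/allP/(_ x).
  rewrite mem_iota ltx code_seqsE table_actE => /(_ isT)/eqP.
  by rewrite nth_index // -index_mem.
apply/allP => i _; apply/allP => x; rewrite mem_iota => ltx.
rewrite code_seqsE table_actE; apply/eqP; case: (ltnP i (size D)) => [lti|lei].
  by apply: rel_ok ltx; apply: mem_nth.
by rewrite nth_default.
Qed.

Section WitnessOfGroup.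
Local Open Scope group_scope.
Variables (F : finGroupType) (val : nat -> F) (N : nat) (D : seq (seq nat)).
Let e := CodeSeq.code (map CodeSeq.code D).
Hypotheses (N6 : 6 <= N) (DN : forall r, r \in D -> all (gtn N) r).
Hypothesis D1 : forall r, r \in D -> \prod_(c <- r) val c = 1.
Hypothesis comm1 : \prod_(c <- comm_word e`!) val c <> 1.

Let elt x : F := nth 1 (enum F) x.
Let idx (f : F) := index f (enum F).

Let idx_lt f : (idx f < #|F|)%N.
Proof. by rewrite cardE index_mem mem_enum. Qed.
Let idxK f : elt (idx f) = f.
Proof. by rewrite /elt nth_index ?mem_enum. Qed.
Let eltK x : (x < #|F|)%N -> idx (elt x) = x.
Proof. by move=> ltx; rewrite /idx index_uniq ?enum_uniq -?cardE. Qed.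

(** The regular action by right translation: the index j = c * #|F| + x encodes the letter c and the
    element numbered x. *)
Let s := CodeSeq.code (#|F|.-1 ::
  mkseq (fun j => idx (elt (j %% #|F|) * val (j %/ #|F|))) (N * #|F|)).

Let F_gt0 : (0 < #|F|)%N.
Proof. by apply/card_gt0P; exists 1. Qed.

Let degree_s : degree s = #|F|.
Proof. by rewrite /degree code_nthE prednK. Qed.

Let stepE x c : (x < #|F|)%N -> (c < N)%N ->
  table_step s x c = idx (elt x * val c).
Proof.
move=> ltx ltc; rewrite /table_step degree_s code_tailE code_nthE nth_mkseq; last first.
  by nia.
by rewrite modnMDl divnMDl // divn_small // addn0 !modn_small.
Qed.

Let foldlE r x : all (gtn N) r -> (x < #|F|)%N ->
  foldl (table_step s) x r = idx (elt x * \prod_(c <- r) val c).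
Proof.
elim: r x => [|c r IHr] x /=; first by rewrite big_nil mulg1 => _ /eltK.
by move=> /andP[ltc ltr] ltx; rewrite stepE // IHr // idxK big_cons mulgA.
Qed.

(** The regular action is free, so the single point 0 detects that the commutator is nontrivial. *)
Lemma witness_of_group : exists s, witness e s.
Proof.
exists s; apply/witnessP; rewrite degree_s; split=> [r x rD ltx|].
  by rewrite foldlE ?DN // D1 // mulg1 eltK.
rewrite foldlE //; last first.
  have ltN c : (c < 6)%N -> (c < N)%N by move=> ltc; apply: leq_trans N6.
  by rewrite /comm_word; do 4 rewrite all_cat all_nseq /= ?ltN // orbT.
move=> idx0; apply: comm1; apply: (mulgI (elt 0)).
by rewrite mulg1 -[LHS]idxK idx0.
Qed.

End WitnessOfGroup.

(** On [0, k) the map is a permutation, whose order divides k! and hence K!. *)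
Lemma iter_fact k (f : nat -> nat) K x :
    (forall y, y < k -> f y < k) ->
    (forall y z, y < k -> z < k -> f y = f z -> y = z) ->
  k <= K -> x < k -> iter K`! f x = x.
Proof.
move=> f_lt f_inj leK ltx; pose fo (y : 'I_k) := Ordinal (f_lt y (ltn_ord y)).
have fo_inj : injective fo.
  by move=> y z [] /f_inj yz; apply/val_inj/yz.
have iterE m (y : 'I_k) : val ((perm fo_inj ^+ m)%g y) = iter m f y.
  rewrite permX; elim: m => //= m IHm; by rewrite permE /= IHm.
have := iterE K`! (Ordinal ltx) => /= <-.
suff -> : (perm fo_inj ^+ K`! = 1)%g by rewrite perm1.
have /dvdnP[q ->] := dvdn_fact2 leK; rewrite mulnC expgM.
suff -> : (perm fo_inj ^+ k`! = 1)%g by rewrite expg1n.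
by rewrite -card_Sn -cardsT expg_cardG ?inE.
Qed.

(** * The commutators and the group G *)

Definition comm_letters m : word 3 :=
  let A := Ordinal (isT : 0 < 3) in let B := Ordinal (isT : 1 < 3) in
  let T := Ordinal (isT : 2 < 3) in
  nseq m (T, false) ++ (A, false) :: nseq m (T, true) ++ (B, false) ::
  nseq m (T, false) ++ (A, true) :: nseq m (T, true) ++ [:: (B, true)].

Lemma word_code_comm m : word_code (comm_letters m) = comm_word m.
Proof.
by rewrite /word_code; do 4 rewrite map_cat map_nseq /=.
Qed.

Section MachineComm.
Local Open Scope ring_scope.
Variables (M : nat) (d : 'Z_M).

Lemma machine_comm m x y p :
  foldl (fun X c => step d c X) (x, y, p) (comm_word m) =
    (x, y + (d == m%:R)%:R, p).
Proof.
have up x' y' p' : iter m (step d 4) (x', y', p') = (x', y', p' + m%:R).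
  elim: m => [|k IHk]; first by rewrite addr0.
  by rewrite iterS IHk /step /= -addrA -mulrSr.
have down x' y' p' : iter m (step d 5) (x', y', p') = (x', y', p' - m%:R).
  elim: m {up} => [|k IHk]; first by rewrite subr0.
  by rewrite iterS IHk /step /= -addrA -opprD -mulrSr.
have cons X c s : foldl (fun X c => step d c X) X (c :: s) =
  foldl (fun X c => step d c X) (step d c X) s by [].
have tK (t : {ffun 'Z_M -> 'F_2}) q :
    [ffun r => [ffun r => t r + (r == q)%:R] r + (r == q)%:R] = t.
  by apply/ffunP=> r; rewrite !ffunE -addrA addF2K addr0.
have toggleE c x' y' p' : (c <= 1)%N ->
    step d c (x', y', p') = ([ffun r => x' r + (r == p')%:R], y', p').
  by rewrite /step => ->.
have readE x' y' p' : step d 2 (x', y', p') = (x', y' + x' (p' + d), p') by [].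
rewrite /comm_word foldl_cat foldl_nseq up cons toggleE // foldl_cat foldl_nseq down.
rewrite cons readE foldl_cat foldl_nseq addrK up cons toggleE // tK.
rewrite foldl_cat foldl_nseq down addrK /= /step /= ffunE; congr (_, _, _).
rewrite (inj_eq (addrI p)) -!addrA; congr (_ + _).
by rewrite addrCA addF2K addr0.
Qed.

End MachineComm.

Definition trivial_letters (w : word 3) :=
  trivial_word killed (code_nth^~ (encode_word w)) (code_size (encode_word w)).

Lemma trivial_lettersP w : reflect
  (forall M (d : 'Z_M), (forall a, killed a -> a%:R != d)%R ->
   eval_word (machine d) w = 1%g) (trivial_letters w).
Proof.
have runE M (d : 'Z_M) X :
  run d (code_nth^~ (encode_word w)) (code_size (encode_word w)) X =
    eval_word (machine d) w X.
  rewrite machine_wordE -run_foldl code_sizeE; apply: eq_run => i _.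
  by rewrite code_nthE.
apply: (iffP idP) => [/trivial_word_run tw M d /tw tX|tw].
  by apply/permP => X; rewrite perm1 -runE tX.
apply: (run_trivial_word closed_mod_killed) => M d /tw wX X.
by rewrite runE wX perm1.
Qed.

(** If m is outside the set, closedness yields an admissible machine with d = m, which detects the
    commutator; if m is inside, no admissible machine has d = m. *)
Lemma trivial_letters_comm m : trivial_letters (comm_letters m) = killed m.
Proof.
apply/trivial_lettersP/idP => [tm|km M d dP].
  apply/idPn => nkm; have := closed_mod_killed 1 (_ : ~~ ((0 <= m) && killed (m - 0))).
  rewrite subn0 => /(_ nkm)[M ltM MP].
  have: eval_word (machine (m%:R : 'Z_M)%R) (comm_letters m) = 1%g.
    apply: tm => a /MP; rewrite addn0; apply: contra => /eqP/(congr1 val) /=.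
    by rewrite !val_Zp_nat // => /eqP.
  move/permP/(_ (0, 0, 0)%R)/(congr1 (fun X : state M => X.1.2)).
  by rewrite machine_wordE word_code_comm machine_comm perm1 eqxx.
apply/permP=> -[[x y] p]; rewrite machine_wordE word_code_comm machine_comm perm1.
by rewrite eq_sym (negPf (dP _ km)) addr0.
Qed.

Lemma exists_group : exists (G : groupType) (g : 'I_3 -> G),
  [/\ generates g, residually_finite G,
      decidable_words [pred w | eval_word g w == 1%g] &
      forall m, (eval_word g (comm_letters m) == 1%g) = killed m].
Proof.
(* All admissible machines: a modulus with a reading distance that avoids the residues of the
   set. *)
pose I := {p : {M : nat & 'Z_M} | forall a, killed a -> (a%:R != projT2 p)%R}.
pose K (i : I) : finGroupType := {perm state (projT1 (sval i))}.
pose mach (i : I) : 'I_3 -> K i := machine (projT2 (sval i)).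
have [w|G [g [gen_g gT gK]]] := @residual_group 3 I K mach trivial_letters.
  split=> [/trivial_lettersP tw [[M d] dP]|tw]; first exact: tw.
  apply/trivial_lettersP => M d dP.
  exact: (tw (exist _ (existT _ M d) dP)).
exists G, g; split=> //; last by move=> m; rewrite gT trivial_letters_comm.
  move=> q q1; have [w wq] := gen_g q.
  have nt : ~ forall M (d : 'Z_M), (forall a, killed a -> a%:R != d)%R ->
      eval_word (machine d) w = 1%g.
    by move/trivial_lettersP => tw; apply: q1; rewrite -wq; apply/eqP; rewrite gT.
  (* A nontrivial word acts nontrivially in some admissible machine, and the permutation group of
     its states is the finite quotient sought. *)
  apply: NNPP => no_F; apply: nt => M d dP.
  pose i : I := exist _ (existT _ M d) dP; have [phi phiE] := gK i.
  rewrite -[LHS](phiE w) wq; apply: NNPP => phi1; apply: no_F.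
  by exists (K i), phi.
have [c cP] := @computable_trivial_word 1 _ (computable_nth 1 0).
exists c => w; rewrite /= gT; exact: (cP [:: encode_word w]).
Qed.

(** * Overgroups *)

Section NoEmbedding.
Local Open Scope group_scope.
Variables (G H : groupType) (g : 'I_3 -> G).
Hypothesis gP : forall m, (eval_word g (comm_letters m) == 1) = killed m.
Variables (n : nat) (a : 'I_n -> H) (R : seq (word n)).
Hypotheses (presH : presents a R) (rfH : residually_finite H).
Variables (phi : {multiplicative G -> H}) (h : 'I_3 -> word n).
Hypotheses (phi_inj : injective phi) (hP : forall i, eval_word a (h i) = phi (g i)).

(* The codes below 6 are kept for the generators of G. *)
Definition shifted_code k (w : word k) : seq nat := map (addn 6) (word_code w).

Definition image_word (l : letter 3) : word n :=
  if l.2 then word_inv (h l.1) else h l.1.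

(** The second family makes formally inverse letters act as inverses, since a table need not act by
    permutations. The third ties each letter of G to a word for its image in H. *)
Definition relators : seq (seq nat) :=
  [seq shifted_code r | r <- R]
  ++ [seq shifted_code [:: l; letter_inv l] | l : letter n <- enum {: letter n}]
  ++ [seq letter_code l :: shifted_code (word_inv (image_word l))
         | l : letter 3 <- enum {: letter 3}].

Let e := CodeSeq.code (map CodeSeq.code relators).

Lemma eval_image_word l : eval_word a (image_word l) = phi (eval_letter g l).
Proof.
rewrite /image_word /eval_letter; case: l.2; rewrite ?eval_word_inv hP //.
by rewrite multiplicativeV.
Qed.

Lemma eval_image_words w : eval_word a (flatten (map image_word w)) =
  phi (eval_word g w).
Proof.
elim: w => [|l w IHw] /=; first by rewrite !eval_word1 multiplicative1.
by rewrite eval_word_cat eval_image_word IHw eval_word_cons gmulfM.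
Qed.

Lemma shifted_code_cat k (u v : word k) :
  shifted_code (u ++ v) = shifted_code u ++ shifted_code v.
Proof. by rewrite /shifted_code /word_code !map_cat. Qed.

Lemma eval_relator r : r \in R -> eval_word a r = 1.
Proof.
move=> rR; rewrite -(eval_word1 a); apply/presH.2.
by have := presented_relator [::] [::] rR; rewrite cats0.
Qed.

(** * From finite quotients of H to witnesses *)

Section Completeness.
Variables (F : finGroupType) (psi : {multiplicative H -> F}).

Definition letter_value k (b : 'I_k -> F) c : F :=
  oapp (fun i => eval_letter b (i, odd c)) 1 (insub c./2).

Lemma letter_valueE k (b : 'I_k ->
  F) l : letter_value b (letter_code l) = eval_letter b l.
Proof.
case: l => i s; rewrite /letter_value /letter_code /= addnC half_bit_double.
by rewrite oddD odd_double addbF oddb valK.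
Qed.

Definition code_value c : F :=
  if c < 6 then letter_value (psi \o (phi \o g)) c else letter_value (psi \o a) (c - 6).

Lemma letter_code_lt k (l : letter k) : letter_code l < k.*2.
Proof. by case: l => i [] /=; rewrite /letter_code /=; have := ltn_ord i; lia. Qed.

Lemma code_value_letter (l : letter 3) : code_value (letter_code l) =
  psi (phi (eval_letter g l)).
Proof.
rewrite /code_value (letter_code_lt l) letter_valueE.
by rewrite /eval_letter /=; case: l.2; rewrite ?multiplicativeV.
Qed.

Lemma code_value_word (w : word 3) :
  \prod_(c <- word_code w) code_value c = psi (phi (eval_word g w)).
Proof.
elim: w => [|l w IHw]; first by rewrite big_nil eval_word1 !multiplicative1.
by rewrite /= big_cons IHw code_value_letter eval_word_cons !gmulfM.
Qed.

Lemma code_value_shifted (w : word n) :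
  \prod_(c <- shifted_code w) code_value c = psi (eval_word a w).
Proof.
rewrite eval_word_morph /shifted_code !big_map; apply: eq_bigr => l _.
by rewrite /code_value ltnNge leq_addr /= addKn letter_valueE.
Qed.

Lemma relators_bounded r : r \in relators -> all (gtn (6 + n.*2)) r.
Proof.
have shifted_lt (w : word n) : all (gtn (6 + n.*2)) (shifted_code w).
  by apply/allP => c /mapP[d /mapP[l _ ->] ->] /=; rewrite ltn_add2l letter_code_lt.
rewrite !mem_cat => /or3P[] /mapP[l _ ->] //; rewrite /= shifted_lt andbT.
exact: leq_trans (letter_code_lt l) (leq_addr _ _).
Qed.

Lemma relators_value r : r \in relators -> \prod_(c <- r) code_value c = 1.
Proof.
rewrite !mem_cat => /or3P[] /mapP[l lR ->].
- by rewrite code_value_shifted eval_relator ?multiplicative1.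
- rewrite code_value_shifted !eval_word_cons eval_word1 mulg1 eval_letter_inv mulgV.
  exact: multiplicative1.
rewrite big_cons code_value_letter code_value_shifted eval_word_inv eval_image_word.
by rewrite -gmulfM mulgV multiplicative1.
Qed.

End Completeness.

(** As e! is not killed, its commutator is nontrivial in G, hence in H by injectivity, hence in some
    finite quotient of H, whose regular action is a witness. *)
Lemma witness_exists : exists s, witness e s.
Proof.
have nt : phi (eval_word g (comm_letters e`!)) <> 1.
  rewrite -(multiplicative1 phi) => /phi_inj/eqP; rewrite gP.
  exact/negP/fact_notin_killed.
have [F [psi psi1]] := rfH nt.
apply: (@witness_of_group F (code_value psi) (6 + n.*2)); first exact: leq_addr.
- exact: relators_bounded.
- exact: relators_value.
by rewrite -word_code_comm code_value_word.
Qed.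

(** * Relations of G hold in every action satisfying the relators *)

Section Soundness.
Variable s : nat.
Hypothesis s_rel : forall r x, r \in relators -> x < degree s ->
  foldl (table_step s) x r = x.

Definition same_action u v :=
  forall x, x < degree s -> foldl (table_step s) x u = foldl (table_step s) x v.

Lemma foldl_table_lt u x : x < degree s -> foldl (table_step s) x u < degree s.
Proof.
elim: u x => //= c u IHu x _; apply: IHu; exact: table_step_lt.
Qed.

Lemma same_action_insert u v r :
  same_action r [::] -> same_action (u ++ r ++ v) (u ++ v).
Proof. by move=> r1 x ltx; rewrite !foldl_cat r1 // foldl_table_lt. Qed.

Lemma presented_same_action u v :
  presented_eq R u v -> same_action (shifted_code u) (shifted_code v).
Proof.
elim=> {u v} [u|u v _ uv|u v w _ uv _ vw|u v l|u v r rR] x ltx //.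
- by rewrite uv.
- by rewrite uv ?vw.
- rewrite !shifted_code_cat; apply: same_action_insert (ltx) => {ltx}x ltx.
  apply: s_rel (ltx); rewrite !mem_cat.
  by rewrite (map_f (fun l => shifted_code [:: l; letter_inv l])) ?mem_enum ?orbT.
rewrite !shifted_code_cat; apply: same_action_insert (ltx) => {ltx}x ltx.
by apply: s_rel (ltx); rewrite !mem_cat map_f.
Qed.

(** The relator says that [l] followed by the inverse of its image word acts trivially. Appending
    the image word and cancelling in H gives the claim. *)
Lemma letter_same_action l :
  same_action [:: letter_code l] (shifted_code (image_word l)).
Proof.
move=> x ltx; pose y := table_step s x (letter_code l).
have lty : y < degree s := table_step_lt s x _.
have inv_image : presented_eq R (word_inv (image_word l) ++ image_word l) [::].
  by apply/presH.2; rewrite eval_word_cat eval_word_inv mulVg eval_word1.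
have yE := presented_same_action inv_image lty.
rewrite shifted_code_cat foldl_cat /= in yE; rewrite -[LHS]/y -{}yE.
congr (foldl _ _ _); apply: (s_rel (r := letter_code l :: _)) (ltx).
rewrite !mem_cat (map_f (fun l =>
  letter_code l :: shifted_code (word_inv (image_word l)))).
  by rewrite !orbT.
by rewrite mem_enum.
Qed.

Lemma word_same_action w :
  same_action (word_code w) (shifted_code (flatten (map image_word w))).
Proof.
elim: w => //= l w IHw x ltx; rewrite shifted_code_cat foldl_cat.
by rewrite -letter_same_action //= IHw // table_step_lt.
Qed.

(** A relation of G maps to a relation of H, which follows from the presentation and therefore holds
    in the action. *)
Lemma trivial_same_action w : eval_word g w = 1 -> same_action (word_code w) [::].
Proof.
move=> w1 x ltx; rewrite word_same_action //.
suff : presented_eq R (flatten (map image_word w)) [::].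
  by move/presented_same_action => ->.
by apply/presH.2; rewrite eval_image_words w1 multiplicative1 eval_word1.
Qed.

Lemma table_pow_fact c c' K x :
    (forall x, x < degree s -> foldl (table_step s) x [:: c; c'] = x) ->
  degree s <= K -> x < degree s -> table_pow s K`! c x = x.
Proof.
move=> cc' leK ltx; apply: (@iter_fact (degree s)) leK ltx => y *.
  exact: table_step_lt.
by rewrite -[y]cc' //= -[RHS]cc' //=; congr table_step.
Qed.

(** T and T^-1 act as inverse permutations of [degree s] points, so their K!-th powers act
    trivially. *)
Lemma table_comm_periodic K m x : degree s <= K -> x < degree s ->
  table_comm s (m + K`!) x = table_comm s m x.
Proof.
move=> leK ltx; pose T := Ordinal (isT : 2 < 3).
have invT b : same_action (word_code [:: (T, b); (T, ~~ b)]) [::].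
  by apply: trivial_same_action; rewrite !eval_word_cons eval_word1 mulg1
    -[(T, ~~ b)]/(letter_inv (T, b)) eval_letter_inv mulgV.
have powD c c' y : same_action [:: c; c'] [::] -> y < degree s ->
    table_pow s (m + K`!) c y = table_pow s m c y.
  move=> cc' lty; rewrite /table_pow iterD; congr iter.
  exact: (table_pow_fact cc').
have lt_step y c : table_step s y c < degree s := table_step_lt s y c.
rewrite /table_comm (powD 4 5 x (invT false)) // (powD 5 4 _ (invT true)) //.
by rewrite (powD 4 5 _ (invT false)) // (powD 5 4 _ (invT true)).
Qed.

End Soundness.

Lemma no_embedding_data : False.
Proof.
have [s0 ws0] := witness_exists.
have ex_w : exists s, witness e s by exists s0.
case: (ex_minnP ex_w) => s ws min_s.
have /witnessP[s_rel mv] := ws.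
pose K := e + s + 2.
(* The degree is 1 plus the 2-adic valuation of s, hence at most s + 1; this is why s enters the
   factorial in [killed]. *)
have leK : degree s <= K.
  have := ltn_logl 2; rewrite /degree /code_nth /= /K => lt_log.
  by case: (posnP s) => [->|/lt_log]; [rewrite logn0; lia | lia].
have killedK : killed (e`! + K`!).
  apply/killedP; right; exists e, s; split=> //.
  rewrite /first_witness ws; apply/allP => s'; rewrite mem_iota add0n /= => lts.
  by apply/negP => /min_s; rewrite leqNgt lts.
(* By periodicity the commutator of e! acts as that of e! + K!, which is trivial in G and so in the
   action. *)
apply: mv; rewrite -table_commE -(table_comm_periodic s_rel _ leK) // table_commE.
rewrite -word_code_comm (trivial_same_action s_rel) //.
by apply/eqP; rewrite gP.
Qed.

End NoEmbedding.

Lemma no_embedding (G H : groupType) (g : 'I_3 -> G) :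
    (forall m, (eval_word g (comm_letters m) == 1%g) = killed m) ->
  finitely_presented H -> residually_finite H -> ~ embeds G H.
Proof.
move=> gP [n [a [R presH]]] rfH [phi phi_inj].
have [h hP] := fin_all_exists (fun i => presH.1 (phi (g i))).
exact: (no_embedding_data gP presH rfH phi_inj hP).
Qed.

Theorem theorem1 :
  exists G : groupType,
    finitely_generated G /\ residually_finite G /\ solvable_word_problem G /\
    forall H : groupType,
      finitely_presented H -> residually_finite H -> ~ embeds G H.
Proof.
have [G [g [gen_g rfG decG gP]]] := exists_group.
exists G; split; first by exists 3, g.
split=> //; split; first by exists 3, g.
by move=> H; apply: no_embedding gP.
Qed.
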